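(* Let $X$ be a Tychonoff space and let $\aleph_\alpha\geq\aleph_1$ be a cardinal. The following statements are equivalent: (1) $X$ is finite. (2) $C_{\aleph_\alpha}(X)$ is locally compact. (3) $C_{\aleph_\alpha}(X)$ is locally countably compact. (4) $C_{\aleph_\alpha}(X)$ is locally pseudocompact. (5) $C_{\aleph_\alpha}(X)$ is hemicompact. (6) $C_{\aleph_\alpha}(X)$ is $\sigma$-compact.
   Context: Tychonoff means completely regular and Hausdorff. A space is locally compact (locally countably compact, locally pseudocompact) if every point has a compact (countably compact, pseudocompact) neighborhood; a space is pseudocompact if every real-valued continuous function on it is bounded. A space $Y$ is hemicompact if there is a countable family $\{K_n: n\in\mathbb{N}\}$ of compact subsets of $Y$ such that every compact $K\subseteq Y$ satisfies $K\subseteq K_n$ for some $n$. $C(X)$ is the set of all real-valued continuous functions on $X$. For an infinite cardinal $\aleph_\alpha$, $\mathcal{A}_{\aleph_\alpha}=\{A\subseteq X: |A|<\aleph_\alpha\}$. For $f\in C(X)$, $A\in\mathcal{A}_{\aleph_\alpha}$ and real $\epsilon>0$ put $B(f,A,\epsilon)=\{g\in C(X): \sup_{x\in A}|f(x)-g(x)|<\epsilon\}$ (equal to $C(X)$ when $A=\emptyset$). The sets $B(f,A,\epsilon)$ form a base of a topology on $C(X)$; $C_{\aleph_\alpha}(X)$ denotes $C(X)$ with this topology. *)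

(* Defs.v *)
From HB Require Import structures.
From mathcomp Require Import all_boot all_order all_algebra.
From mathcomp Require Import finmap.
From mathcomp Require Import all_classical all_reals all_analysis.
From mathcomp Require Import lra.

Set Implicit Arguments.
Unset Strict Implicit.
Unset Printing Implicit Defensive.

Import Order.TTheory GRing.Theory Num.Theory.
Import numFieldNormedType.Exports.

Local Open Scope classical_set_scope.
Local Open Scope ring_scope.

(* A cardinal is represented by any type of that cardinality. By the axiom of
   choice, the infinite cardinals are exactly the alephs, and those that are at
   least aleph_1 (the least uncountable cardinal) are the uncountable ones. *)
Record infinite_cardinal := InfiniteCardinal {
  card_carrier :> Type;
  card_infinite : infinite_set [set: card_carrier]
}.

Definition card_lt (T U : Type) (A : set T) (B : set U) : Prop :=
  (A #<= B)%card /\ ~ (B #<= A)%card.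

Section cardinal_arithmetic.
Local Open Scope card_scope.

Lemma card_le_rel (T U : Type) (A : set T) (B : set U) (R : T -> U -> Prop) :
  (forall x, A x -> exists2 y, B y & R x y) ->
  (forall x x' y, A x -> A x' -> R x y -> R x' y -> x = x') ->
  A #<= B.
Proof.
move=> tot inj.
have [->|/set0P[a0 Aa0]] := eqVneq A set0; first exact: card_ge0.
have [b0 _ _] := tot _ Aa0.
pose U' : pointedType := HB.pack U (isPointed.Build U b0)
  (gen_eqMixin U) (gen_choiceMixin U).
have /choice[f fP] : forall x, exists y : U', A x -> B y /\ R x y.
  move=> x; have [/tot[y By Rxy]|nAx] := pselect (A x); first by exists y.
  by exists b0.
apply: (@card_le_trans _ _ _ (f @` A)); last first.
  by apply: subset_card_le => _ [x Ax <-]; have [] := fP _ Ax.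
have /card_eqPle[_] // : f @` A #= A.
apply: inj_card_eq => x y; rewrite !inE => Ax Ay fxy.
apply: (inj x y (f x)) => //; first by have [] := fP _ Ax.
by rewrite fxy; have [] := fP _ Ay.
Qed.

Lemma card_le_fun (T U : Type) (A : set T) (B : set U) : A #<= B ->
  A !=set0 -> exists2 f : T -> U, (forall x, A x -> B (f x)) &
    (forall x y, A x -> A y -> f x = f y -> x = y).
Proof.
move=> AB [a0 Aa0].
have [b0 Bb0] : B !=set0.
  by apply/set0P/eqP => B0; move: AB; rewrite B0 card_le0 => /eqP A0; rewrite A0 in Aa0.
pose U' : pointedType := HB.pack U (isPointed.Build U b0)
  (gen_eqMixin U) (gen_choiceMixin U).
have /(@pcard_leP _ U')/injfunPex[f fAB finj] := AB.
exists f => // x y Ax Ay; by apply: finj; rewrite inE.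
Qed.

Lemma card_le_total (T U : Type) (A : set T) (B : set U) :
  A #<= B \/ B #<= A.
Proof.
pose P := [set G : set (T * U) | [/\ G `<=` A `*` B,
  forall x y y', G (x, y) -> G (x, y') -> y = y' &
  forall x x' y, G (x, y) -> G (x', y) -> x = x']].
have [F FP Ftot|G [[GAB Gf Gi] Gmax]] := @Zorn_bigcup _ P.
  have join X Y p q : F X -> F Y -> X p -> Y q -> exists2 Z, F Z & Z p /\ Z q.
    move=> FX FY Xp Yq; have [XY|YX] := Ftot _ _ FX FY.
      by exists Y => //; split=> //; exact: XY.
    by exists X => //; split=> //; exact: YX.
  split.
  - by move=> p [X FX Xp]; have [XAB _ _] := FP _ FX; exact: XAB.
  - move=> x y y' [X FX Xp] [Y FY Yp].
    have [Z FZ [Zp Zq]] := join _ _ _ _ FX FY Xp Yp.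
    by have [_ h _] := FP _ FZ; exact: h Zp Zq.
  - move=> x x' y [X FX Xp] [Y FY Yp].
    have [Z FZ [Zp Zq]] := join _ _ _ _ FX FY Xp Yp.
    by have [_ _ h] := FP _ FZ; exact: h Zp Zq.
have [domA|] := pselect (forall x, A x -> exists y, G (x, y)).
  left; apply: (@card_le_rel _ _ _ _ (fun x y => G (x, y))).
    by move=> x /domA[y Gxy]; exists y => //; have [] := GAB _ Gxy.
  by move=> x x' y _ _; exact: Gi.
move=> /existsNP[a /not_implyP[Aa /forallNP Ga]].
have [ranB|] := pselect (forall y, B y -> exists x, G (x, y)).
  right; apply: (@card_le_rel _ _ _ _ (fun y x => G (x, y))).
    by move=> y /ranB[x Gxy]; exists x => //; have [] := GAB _ Gxy.
  by move=> y y' x _ _; exact: Gf.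
move=> /existsNP[b /not_implyP[Bb /forallNP Gb]].
exfalso; apply: (Gmax (G `|` [set (a, b)])).
  split; first exact: subsetUl.
  by move=> /(_ (a, b) (or_intror erefl)); exact: Ga.
split.
- by move=> p [/GAB//|->].
- move=> x y y' [Gxy|[xa yb]] [Gxy'|[xa' yb']]; subst => //.
  + exact: Gf Gxy Gxy'.
  + by have := Ga _ Gxy.
  + by have := Ga _ Gxy'.
- move=> x x' y [Gxy|[xa yb]] [Gxy'|[xa' yb']]; subst => //.
  + exact: Gi Gxy Gxy'.
  + by have := Gb _ Gxy.
  + by have := Gb _ Gxy'.
Qed.

Lemma card_le_setXbool (T U : Type) (A : set T) (B : set U) :
  A #<= B -> A `*` [set: bool] #<= B `*` [set: bool].
Proof.
move=> AB; have [->|/set0P A0] := eqVneq A set0; first by rewrite set0X card_ge0.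
have [f fAB fi] := card_le_fun AB A0.
apply: (@card_le_rel _ _ _ _ (fun p q => q = (f p.1, p.2))).
  by move=> [x b] [/= Ax _]; exists (f x, b) => //; split => //; exact: fAB.
by move=> [x b] [x' b'] q [/= Ax _] [/= Ax' _] -> [/fi -> // ->].
Qed.

Lemma card_le_double (T : Type) (A : set T) : infinite_set A ->
  A `*` [set: bool] #<= A.
Proof.
move=> infA.
pose P := [set G : set (T * bool * T) | [/\
  forall p y, G (p, y) -> A y,
  forall p y y', G (p, y) -> G (p, y') -> y = y',
  forall p p' y, G (p, y) -> G (p', y) -> p = p',
  forall p y, G (p, y) -> exists q, G (q, p.1) &
  forall p y b, G (p, y) -> exists z, G ((y, b), z)]].
have [F FP Ftot|G [[GA Gf Gi Gd Gr] Gmax]] := @Zorn_bigcup _ P.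
  have join X Y p q : F X -> F Y -> X p -> Y q -> exists2 Z, F Z & Z p /\ Z q.
    move=> FX FY Xp Yq; have [XY|YX] := Ftot _ _ FX FY.
      by exists Y => //; split=> //; exact: XY.
    by exists X => //; split=> //; exact: YX.
  split.
  - by move=> p y [X FX Xp]; have [h _ _ _ _] := FP _ FX; exact: h Xp.
  - move=> x y y' [X FX Xp] [Y FY Yp].
    have [Z FZ [Zp Zq]] := join _ _ _ _ FX FY Xp Yp.
    by have [_ h _ _ _] := FP _ FZ; exact: h Zp Zq.
  - move=> x x' y [X FX Xp] [Y FY Yp].
    have [Z FZ [Zp Zq]] := join _ _ _ _ FX FY Xp Yp.
    by have [_ _ h _ _] := FP _ FZ; exact: h Zp Zq.
  - move=> p y [X FX Xp]; have [_ _ _ h _] := FP _ FX.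
    by have [q Xq] := h _ _ Xp; exists q, X.
  - move=> p y b [X FX Xp]; have [_ _ _ _ h] := FP _ FX.
    by have [q Xq] := h _ _ b Xp; exists q, X.
pose S := [set y | exists p, G (p, y)].
have SA : S `<=` A by move=> y [p /GA].
have [finD|infD] := pselect (finite_set (A `\` S)); last first.
  have /infiniteP NS := infD.
  have [|f fS fi] := card_le_fun NS; first by exists 0%N.
  have {}fi n m : f n = f m -> n = m by exact: fi.
  have fA n : A (f n) by have [] := fS n I.
  have fnS n p : ~ G (p, f n).
    by move=> Gp; have [_] := fS n I; apply; exists p.
  pose H := [set r : T * bool * T | exists n (b : bool),
    r = ((f n, b), f (n.*2 + b)%N)].
  have fnd n b y : ~ G ((f n, b), y) by move=> /Gd[q] /=; exact: fnS.
  exfalso; apply: (Gmax (G `|` H)).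
    split; first exact: subsetUl.
    move=> /(_ ((f 0%N, false), f 0%N)) HG; apply: (@fnS 0%N (f 0%N, false)).
    by apply: HG; right; exists 0%N, false.
  split.
  - by move=> p y [/GA//|[n [b [_ ->]]]].
  - move=> p y y' [Gp|[n [b [pE yE]]]] [Gp'|[n' [b' [pE' yE']]]]; subst.
    + exact: Gf Gp Gp'.
    + by have := fnd _ _ _ Gp.
    + by have := fnd _ _ _ Gp'.
    + by case: pE' => /fi -> ->.
  - move=> p p' y [Gp|[n [b [pE yE]]]] [Gp'|[n' [b' [pE' yE']]]]; subst.
    + exact: Gi Gp Gp'.
    + by have := fnS _ _ Gp.
    + by have := fnS _ _ Gp'.
    + move/fi: yE' => nn.
      have bb : b = b'.
        by have := congr1 odd nn; rewrite !oddD !odd_double /= !oddb.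
      by move: nn; rewrite bb => /eqP; rewrite eqn_add2r => /eqP/double_inj ->.
  - move=> p y [/Gd[q Gq]|[n [b [-> _]]]]; first by exists q; left.
    exists (f n./2, odd n); right; exists n./2, (odd n).
    by rewrite addnC odd_double_half.
  - move=> p y b [/(Gr _ _ b)[z Gz]|[n [b' [_ ->]]]]; first by exists z; left.
    by exists (f ((n.*2 + b').*2 + b)%N); right; exists (n.*2 + b')%N, b.
have infS : infinite_set S.
  move=> finS; apply: infA; apply: (sub_finite_set (B := S `|` A `\` S)).
    by move=> x Ax; have [Sx|nSx] := pselect (S x); [left|right].
  by rewrite finite_setU.
have SS : S `*` [set: bool] #<= S.
  apply: (@card_le_rel _ _ _ _ (fun p y => G (p, y))).
    by move=> [x b] [/= [p /(Gr _ _ b)[z Gz]] _]; exists z => //; exists (x, b).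
  by move=> x x' y _ _; exact: Gi.
have DS : A `\` S #<= S.
  apply: card_le_trans ((infiniteP S).1 infS); exact: finite_set_countable.
have AS2 : A #<= S `*` [set: bool].
  have [D0|/set0P D0] := eqVneq (A `\` S) set0.
    apply: (@card_le_rel _ _ _ _ (fun x q => q = (x, false))).
      move=> x Ax; exists (x, false) => //; split => //=.
      by apply: contrapT => nSx; have : set0 x by rewrite -D0.
    by move=> x x' q _ _ -> [].
  have [h hS hi] := card_le_fun DS D0.
  apply: (@card_le_rel _ _ _ _ (fun x q =>
    (S x /\ q = (x, false)) \/ (~ S x /\ q = (h x, true)))).
    move=> x Ax; have [Sx|nSx] := pselect (S x).
      by exists (x, false) => //; left.
    by exists (h x, true); [split => //=; exact: hS | right].
  move=> x x' q Ax Ax' [[Sx ->]|[nSx ->]] [[Sx' []]|[nSx' []]] //.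
  by apply: hi.
have AS : A #<= S by exact: card_le_trans AS2 SS.
apply: card_le_trans (subset_card_le SA).
by apply: card_le_trans SS; exact: card_le_setXbool.
Qed.

Lemma card_le_setU (T U : Type) (A B : set T) (C : set U) :
  infinite_set C -> A #<= C -> B #<= C -> A `|` B #<= C.
Proof.
move=> infC AC BC; apply: (card_le_trans _ (card_le_double infC)).
have [A0|/set0P A0] := eqVneq A set0.
  rewrite A0 set0U; apply: (card_le_trans BC).
  apply: (@card_le_rel _ _ _ _ (fun x q => q = (x, false))).
    by move=> x Cx; exists (x, false).
  by move=> x x' q _ _ -> [].
have [B0|/set0P B0] := eqVneq B set0.
  rewrite B0 setU0; apply: (card_le_trans AC).
  apply: (@card_le_rel _ _ _ _ (fun x q => q = (x, false))).
    by move=> x Cx; exists (x, false).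
  by move=> x x' q _ _ -> [].
have [f fA fi] := card_le_fun AC A0; have [g gB gi] := card_le_fun BC B0.
apply: (@card_le_rel _ _ _ _ (fun x q =>
  (A x /\ q = (f x, false)) \/ (B x /\ q = (g x, true)))).
  move=> x [Ax|Bx].
    by exists (f x, false); [split => //=; exact: fA | left].
  by exists (g x, true); [split => //=; exact: gB | right].
move=> x x' q _ _ [[Ax ->]|[Bx ->]] [[Ax' []]|[Bx' []]] //.
  exact: fi.
exact: gi.
Qed.

Lemma card_lt_setU (T : Type) (kappa : infinite_cardinal) (A B : set T) :
  card_lt A [set: kappa] -> card_lt B [set: kappa] ->
  card_lt (A `|` B) [set: kappa].
Proof.
have main (D E : set T) : D #<= E -> card_lt E [set: kappa] ->
    ~ ([set: kappa] #<= D `|` E).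
  move=> DE [_ Ek] kDE; have [finE|infE] := pselect (finite_set E).
    apply: (@card_infinite kappa); apply: (card_le_finite kDE).
    by rewrite finite_setU; split => //; exact: card_le_finite DE finE.
  by apply: Ek; apply: (card_le_trans kDE); exact: card_le_setU.
move=> Ak Bk; split.
  by apply: card_le_setU; [exact: card_infinite|exact: Ak.1|exact: Bk.1].
have [AB|BA] := card_le_total A B; first exact: main.
by rewrite setUC; exact: main.
Qed.

End cardinal_arithmetic.

Definition tychonoff_space (X : topologicalType) : Prop :=
  completely_regular_space X /\ hausdorff_space X.

(* [completely_regular_space] is phrased in terms of uniformities; this is the
   usual formulation by real-valued functions. *)
Lemma completely_regular_spaceP (R : realType) (X : topologicalType) :
  completely_regular_space X <->
  forall (a : X) (B : set X), closed B -> ~ B a ->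
    exists f : X -> R, [/\ continuous f, range f `<=` `[0, 1],
      f a = 0 & forall x, B x -> f x = 1].
Proof.
split=> [crX a B cB nBa|H a B cB nBa].
  have /(@uniform_separatorP _ R)[f [cf f01 fa fB]] := crX a B cB nBa.
  exists f; split => //; first by apply: fa; exists a.
  by move=> x Bx; apply: fB; exists x.
have [f [cf f01 fa fB]] := H a B cB nBa.
apply/(@uniform_separatorP _ R); exists f; split => //.
  by move=> _ [x -> <-].
by move=> _ [x Bx <-] /=; exact: fB.
Qed.

Section function_space.
Context {R : realType} {X : topologicalType}.

(* The supremum is taken in the extended reals: it is [+oo] when [f - g] is
   unbounded on [A], and [-oo] when [A] is empty. *)
Definition Bsup (f : continuousType X R) (A : set X) (eps : R) :
    set (continuousType X R) :=
  [set g | (ereal_sup [set `|f x - g x|%:E | x in A] < eps%:E)%E].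

Lemma BsupP (f g : continuousType X R) (A : set X) (eps : R) :
  Bsup f A eps g <->
  exists2 r : R, r < eps & forall x, A x -> `|f x - g x| <= r.
Proof.
split=> [fg|[r reps fgr]]; last first.
  apply: (@le_lt_trans _ _ r%:E); last by rewrite lte_fin.
  by apply: ge_ereal_sup => _ [x Ax <-]; rewrite lee_fin fgr.
have ub x : A x ->
    (`|f x - g x|%:E <= ereal_sup [set `|f x - g x|%:E | x in A])%E.
  by move=> Ax; apply: ereal_sup_ubound; exists x.
move: fg ub; rewrite /Bsup /=; case: ereal_sup => [r| |] //.
  by rewrite lte_fin => reps ub; exists r.
move=> _ ub; exists (eps - 1); first by lra.
by move=> x /ub; rewrite leNgt ltNye.
Qed.

Lemma Bsup_center (f : continuousType X R) (A : set X) (eps : R) :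
  0 < eps -> Bsup f A eps f.
Proof.
by move=> e0; apply/BsupP; exists 0 => // x _; rewrite subrr normr0.
Qed.

Lemma Bsup_refine (f g : continuousType X R) (A : set X) (eps : R) :
  Bsup f A eps g ->
  exists2 del, 0 < del & forall A' del', A `<=` A' -> del' <= del ->
    Bsup g A' del' `<=` Bsup f A eps.
Proof.
move=> /BsupP[r reps fgr]; exists (eps - r); first by rewrite subr_gt0.
move=> A' del' AA' dd h /BsupP[s sdel ghs]; apply/BsupP.
exists (r + s); first by lra.
move=> x Ax; rewrite (_ : f x - h x = (f x - g x) + (g x - h x)); last by lra.
by apply: (le_trans (ler_normD _ _)); apply: lerD; [exact: fgr|apply/ghs/AA'].
Qed.

End function_space.

(* [Caleph kappa X R] is the space of continuous functions from [X] to [R] with the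
   topology having the [Bsup f A eps] with [|A| < kappa] as a base. *)
Definition Caleph (kappa : infinite_cardinal) (X : topologicalType) (R : realType)
  : Type := continuousType X R.

Section Caleph_topology.
Context (kappa : infinite_cardinal) (X : topologicalType) (R : realType).

HB.instance Definition _ := Choice.on (Caleph kappa X R).

Definition Caleph_base : set (set (Caleph kappa X R)) :=
  [set V | exists f A eps,
    [/\ card_lt A [set: kappa], 0 < eps & V = @Bsup R X f A eps]].

Let Caleph_base_cover : \bigcup_(V in Caleph_base) id V = [set: Caleph kappa X R].
Proof.
apply/seteqP; split=> // f _; exists (@Bsup R X f set0 1).
  exists f, set0, 1; split => //; split; first exact: card_ge0.
  by move/card_le_finite => /(_ (finite_set0 _)); exact: card_infinite.
exact: Bsup_center.
Qed.

Let Caleph_base_join (V W : set (Caleph kappa X R)) (g : Caleph kappa X R) :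
  Caleph_base V -> Caleph_base W -> id V g -> id W g ->
  exists U, [/\ Caleph_base U, id U g & id U `<=` id V `&` id W].
Proof.
move=> [f [A [e [Ak e0 ->]]]] [f' [A' [e' [A'k e'0 ->]]]] /=.
move=> /Bsup_refine[d d0 dP] /Bsup_refine[d' d'0 d'P].
have dd0 : 0 < Num.min d d' by rewrite lt_min d0.
exists (@Bsup R X g (A `|` A') (Num.min d d')); split.
- by exists g, (A `|` A'), (Num.min d d'); split => //; exact: card_lt_setU.
- exact: Bsup_center.
- move=> h hU; split.
    by apply: dP hU; [exact: subsetUl|rewrite ge_min lexx].
  by apply: d'P hU; [exact: subsetUr|rewrite ge_min lexx orbT].
Qed.

HB.instance Definition _ := isBaseTopological.Build (Caleph kappa X R)
  Caleph_base_cover Caleph_base_join.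

Lemma Caleph_openE (U : set (Caleph kappa X R)) :
  open U <-> exists2 F, F `<=` Caleph_base & U = \bigcup_(V in F) V.
Proof. by split=> [[F FB <-]|[F FB ->]]; exists F. Qed.

End Caleph_topology.

Section compactness_notions.
Context {Y : topologicalType}.

Definition countably_compact (A : set Y) : Prop :=
  forall U : nat -> set Y, (forall n, open (U n)) ->
    A `<=` cover [set: nat] U -> finite_subset_cover [set: nat] U A.

(* [{within A, continuous f}] is continuity on the subspace [A]; the values of
   [f] outside [A] are irrelevant. *)
Definition pseudocompact (R : realType) (A : set Y) : Prop :=
  forall f : Y -> R, {within A, continuous f} -> [bounded f x | x in A].

Definition every_point_has_nbhs (P : set Y -> Prop) : Prop :=
  forall y : Y, exists2 V, nbhs y V & P V.

End compactness_notions.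

Definition hemicompact (Y : topologicalType) : Prop :=
  exists K : nat -> set Y, (forall n, compact (K n)) /\
    forall L : set Y, compact L -> exists n, L `<=` K n.

Definition sigma_compact (Y : topologicalType) : Prop :=
  exists K : nat -> set Y, (forall n, compact (K n)) /\
    \bigcup_n K n = [set: Y].

(* Main.v *)
(** If X is infinite, complete regularity yields points s_n and functions
    u_n : X -> [0, 1] with u_n(s_n) = 1 and u_n(s_m) = 0 for m < n. Countable
    sets have fewer than aleph_alpha points, so uniform convergence on {s_n} is
    coarser than the topology of C_{aleph_alpha}(X), and the functions f + e u_n
    are uniformly separated on {s_n}. Hence no pseudocompact set contains a
    closed ball {g : |f - g| <= e everywhere}, which refutes local
    pseudocompactness. If C_{aleph_alpha}(X) were the union of compact sets K_n,
    Baire's argument for uniform convergence on X would produce a function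
    outside all of them: these balls are not included in K_n, and K_n is closed.
    If X is finite, it is discrete and the closed balls are compact. *)

Require Import Defs.
From mathcomp Require Import all_boot all_order all_algebra.
From mathcomp Require Import all_classical all_reals all_analysis.
From mathcomp Require Import finmap zify lra.

Set Implicit Arguments.
Unset Strict Implicit.
Unset Printing Implicit Defensive.

Import Order.TTheory GRing.Theory Num.Theory.
Import numFieldNormedType.Exports.

Local Open Scope classical_set_scope.
Local Open Scope ring_scope.

(** * Countable sets and the notions of compactness *)

Lemma countable_card_lt (kappa : infinite_cardinal) (T : Type) (A : set T) :
  ~ countable [set: kappa] -> countable A -> card_lt A [set: kappa].
Proof.
move=> ncK cA; split; last by move=> kA; apply: ncK; exact: card_le_trans kA cA.
apply: (card_le_trans cA); apply/infiniteP; exact: card_infinite.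
Qed.

Lemma compact_countably_compact (Y : topologicalType) (A : set Y) :
  compact A -> countably_compact A.
Proof.
move=> /compact_near_coveringP cA U oU AU.
(* Near each [y], points lie in a fixed [U i] with [i <= n] for all large [n]; compactness makes the
   threshold [N] uniform. *)
have [|N _ /(_ N (leqnn N)) AN] :=
    cA nat \oo (fun n y => exists2 i, (i <= n)%N & U i y) _.
  move=> y Ay; have [i _ Uiy] := AU y Ay.
  exists (U i, [set n | (i <= n)%N]).
    split; last exact: nbhs_infty_ge.
    exact: (open_nbhs_nbhs (conj (oU i) Uiy)).
  by move=> [z n] [/= Uz lin]; exists i.
exists ([fset i in iota 0 N.+1]%fset); first by move=> i _; exact: mem_set.
move=> y /AN[i iN Uiy]; exists i => //=.
by rewrite !inE mem_iota; lia.
Qed.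

(** The relatively open sets where [|f| < n] increase and cover [A], so a finite subcover bounds
    [f]. *)
Lemma countably_compact_pseudocompact (R : realType) (Y : topologicalType)
  (A : set Y) : countably_compact A -> pseudocompact R A.
Proof.
move=> cA f cf.
have /choice[U UP] : forall n : nat, exists V : set Y, open V /\
    V `&` A = [set y | `|f y| < n%:R] `&` A.
  move=> n.
  have : open ([set y | `|f y| < n%:R] : set (subspace A)).
    have /continuousP/(_ _ (@open_lt R n%:R)) :=
      (fun x => cvg_comp _ _ (cf x) (@norm_continuous _ R^o (f x))).
    by [].
  by move=> /open_subspaceP[V oV VA]; exists V.
have UA n y : A y -> U n y <-> `|f y| < n%:R.
  move=> Ay; have [_ /seteqP[h1 h2]] := UP n; split => h.
    by have [] := h1 y (conj h Ay).
  by have [] := h2 y (conj h Ay).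
have [||D _ AD] := cA U.
- by move=> n; have [] := UP n.
- move=> y Ay; exists (Num.truncn `|f y|).+1 => //; apply/UA => //.
  exact: truncnS_gt.
exists (\max_(i <- finmap.enum_fset D) i)%N%:R; split; first exact: num_real.
move=> M BM y Ay; have [i /= iD /UA - /(_ Ay) fi] := AD y Ay.
apply: (le_trans (ltW fi)); apply: le_trans (ltW BM); rewrite ler_nat.
exact: bigmaxn_sup_seq iD _ _.
Qed.

(** * Neighbourhoods in the function space *)

Section function_space.
Context {R : realType} {X : topologicalType} (kappa : infinite_cardinal).
Local Notation C := (continuousType X R).
Local Notation Y := (Caleph kappa X R).
Implicit Types (f g h : C) (V K : set Y).

Lemma open_Bsup g A e :
  card_lt A [set: kappa] -> 0 < e -> open (Bsup g A e : set Y).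
Proof.
move=> Ak e0; apply/Caleph_openE; exists [set Bsup g A e : set Y].
  by move=> _ ->; exists g, A, e.
by rewrite bigcup_set1.
Qed.

Lemma nbhs_CalephP g V :
  nbhs (g : Y) V <-> exists A e, [/\ card_lt A [set: kappa], 0 < e &
    Bsup g A e `<=` V].
Proof.
rewrite nbhsE /=; split.
  move=> [W [/Caleph_openE[F FB ->] [B FB' Bg]] FV].
  have [f [A [e [Ak e0 BE]]]] := FB _ FB'.
  move: Bg; rewrite BE => /Bsup_refine[d d0 dP].
  exists A, d; split => // h hd; apply: FV; exists B => //.
  by rewrite BE; apply: dP hd.
move=> [A [e [Ak e0 BV]]]; exists (Bsup g A e) => //.
by split; [exact: open_Bsup | exact: Bsup_center].
Qed.

Hypothesis ncK : ~ countable [set: kappa].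

(** Uncountability of [kappa] makes every countable set admissible in the base. *)
Lemma nbhs_Bsup g A e : countable A -> 0 < e -> nbhs (g : Y) (Bsup g A e).
Proof.
move=> cA e0; apply/nbhs_CalephP; exists A, e; split => //.
exact: countable_card_lt.
Qed.

Lemma hausdorff_Caleph : hausdorff_space Y.
Proof.
move=> f g fg; apply/continuousEP => x.
apply/eqP; rewrite -subr_eq0 -normr_le0; apply/ler_addgt0Pr => e e0.
have e2 : 0 < e / 2 by rewrite divr_gt0.
have cx : countable [set x] by apply: finite_set_countable; exact: finite_set1.
have [h [/BsupP[r re fh] /BsupP[s se gh]]] :=
  fg _ _ (nbhs_Bsup f cx e2) (nbhs_Bsup g cx e2).
have := fh x erefl; have := gh x erefl.
rewrite !ler_norml => /andP[] ? ? /andP[] ? ?.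
by apply/andP; split; lra.
Qed.

(** The closed ball for uniform convergence on all of [X]; it lies in [Bsup f A d] for every [A] as
    soon as [e < d]. *)
Definition sup_ball f (e : R) : set C := [set g | forall x, `|f x - g x| <= e].

(** * Infinite [X]: large pseudocompact sets and countable compact covers are excluded *)

Section infinite.
Hypotheses (tX : tychonoff_space X) (infX : infinite_set [set: X]).

(** Any injective sequence serves: the points before [s n] form a finite, hence closed, set. Values
    at later points are left free. *)
Lemma separating_sequence : exists (s : nat -> X) (u : nat -> C),
  forall n, [/\ forall x, 0 <= u n x <= 1, u n (s n) = 1 &
    forall m, (m < n)%N -> u n (s m) = 0].
Proof.
have [crX hX] := tX.
have /infiniteP NX := infX.
have [|s _ sI] := card_le_fun NX; first by exists 0%N.
exists s.
suff /choice[u uP] : forall n, exists u : C, [/\ forall x, 0 <= u x <= 1,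
    u (s n) = 1 & forall m, (m < n)%N -> u (s m) = 0] by exists u.
move=> n.
have clB : closed (s @` `I_n).
  apply: (accessible_finite_set_closed.1 (hausdorff_accessible hX)).
  exact/finite_image/finite_II.
have [|v [cv v01 vn vB]] := (completely_regular_spaceP R X).1 crX (s n) _ clB.
  by move=> [m /= mn /sI] mn'; move: mn; rewrite mn' // ltnn.
have cu : continuous (fun x => 1 - v x : R).
  by move=> x; apply: cvgB; [exact: cvg_cst|exact: cv].
exists (mkcts cu); split => /=; rewrite /mkcts.
- move=> x; have /= := v01 (v x) (ex_intro2 _ _ x I erefl).
  by rewrite in_itv /= => /andP[] ? ?; apply/andP; split; lra.
- by rewrite vn subr0.
- by move=> m mn; rewrite vB ?subrr //; exists m.
Qed.

Lemma sup_ball_not_pseudocompact f e V :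
  0 < e -> sup_ball f e `<=` V -> ~ pseudocompact R V.
Proof.
move=> e0 BV pV.
have [s [u uP]] := separating_sequence.
have ch n : continuous (fun x => f x + e * u n x).
  by move=> x; apply: cvgD; [|apply: cvgM; first exact: cvg_cst]; exact: cts_fun.
pose h n : C := mkcts (ch n).
have hE n x : h n x = f x + e * u n x by [].
have Vh n : V (h n).
  apply: BV => x; rewrite hE opprD addrA subrr sub0r normrN normrM gtr0_norm //.
  have [/(_ x)/andP[u0 u1] _ _] := uP n.
  by rewrite ger0_norm // ger_pMr.
(* The smaller index [i] gives the witness [s i], where [u i] is 1 and [u j] is 0. *)
have sep m n : m != n -> exists k, e <= `|h m (s k) - h n (s k)|.
  have wlg i j : (i < j)%N -> e <= `|h i (s i) - h j (s i)|.
    move=> ij; have [_ ui _] := uP i; have [_ _ uj] := uP j.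
    rewrite !hE ui uj // mulr0 addr0 mulr1 (addrC (f _)) addrK.
    exact: ler_norm.
  by case: ltngtP => // [mn|nm] _; [exists m|exists n; rewrite distrC]; exact: wlg.
(* [w g] is, up to truncation at [e], the infimum over [n] of the maximum of
   [1 / (n + 1)] and the uniform distance from [g] to [h n] on the [s k]; it is
   positive because the [h n] are separated, and [1 / w] is unbounded on them. *)
pose S g := [set r : R | e <= r \/ exists n : nat, n.+1%:R^-1 <= r /\
  forall k, `|g (s k) - h n (s k)| <= r].
pose w (g : Y) := inf (S g).
have S0 g : S g !=set0 by exists e; left.
have lbS g : has_lbound (S g).
  exists 0 => r [er|[n [nr _]]]; first by rewrite (le_trans (ltW e0)).
  by apply: le_trans nr; rewrite invr_ge0.
have w_gt0 g : 0 < w g.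
  (* If [h n0] is within [e / 3] of [g], every other [h n] is at distance at least [2 e / 3], and
     the term for [n0] is at least [1 / (n0 + 1)]. *)
  have [[n0 n0P]|far] :=
      pselect (exists n, forall k, `|g (s k) - h n (s k)| <= e / 3).
    apply: (@lt_le_trans _ _ (Num.min (e / 2) n0.+1%:R^-1)).
      by rewrite lt_min invr_gt0 ltr0n andbT; lra.
    apply: lb_le_inf => // r [er|[n [nr gr]]].
      by rewrite ge_min; apply/orP; left; lra.
    rewrite ge_min; have [->|nn0] := eqVneq n0 n; first by rewrite nr orbT.
    apply/orP; left; have [k ek] := sep _ _ nn0.
    have := ler_distD (g (s k)) (h n0 (s k)) (h n (s k)).
    have := n0P k; have := gr k; rewrite (distrC (h n0 _) (g _)); lra.
  apply: (@lt_le_trans _ _ (e / 3)); first by lra.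
  apply: lb_le_inf => // r [er|[n [nr gr]]]; first by lra.
  rewrite leNgt; apply/negP => re; apply: far; exists n => k.
  exact: le_trans (gr k) (ltW re).
have wh n : w (h n) <= n.+1%:R^-1.
  apply: ge_inf => //; right; exists n; split=> // k.
  by rewrite subrr normr0.
(* This Lipschitz bound only involves the countable set [range s], whence continuity of [w]. *)
have w_lip g g' r : (forall k, `|g (s k) - g' (s k)| <= r) -> w g <= w g' + r.
  move=> gg'; rewrite -lerBlDr; apply: lb_le_inf => // t St.
  have r0 : 0 <= r := le_trans (normr_ge0 _) (gg' 0%N).
  rewrite lerBlDr; apply: ge_inf => //; case: St => [et|[n [nt g't]]].
    by left; lra.
  right; exists n; split; first by rewrite (le_trans nt) ?lerDl.
  move=> k; have := ler_distD (g' (s k)) (g (s k)) (h n (s k)).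
  have := gg' k; have := g't k; lra.
have cw : continuous w.
  move=> g; have gF : Filter (nbhs (g : Y)) := nbhs_filter _.
  apply/(@cvgrPdist_le _ _ _ _ gF) => d d0.
  have /nbhs_Bsup/(_ d0) : countable (range s).
    by apply: (card_le_trans (card_image_le _ _)); exact: countableP.
  move=> /(_ g); apply: filterS => g' /BsupP[r rd gg'].
  have {}gg' k : `|g (s k) - g' (s k)| <= d.
    by apply: (le_trans (gg' _ _) (ltW rd)); exists k.
  have := w_lip _ _ _ gg'.
  have g'g k : `|g' (s k) - g (s k)| <= d by rewrite distrC.
  have := w_lip _ _ _ g'g.
  by rewrite ler_norml => ? ?; apply/andP; split; lra.
have /continuous_subspaceT - /(_ V) cF : continuous (fun g : Y => (w g)^-1).
  move=> g; apply: cvgV; [exact: nbhs_filter|exact: lt0r_neq0|exact: cw].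
(* Only numbers above [M0] are known to be bounds, hence [M0 + 1]. At [h n] with [n] the truncation
   of [M], [1 / w] is at least [n + 1 > M]. *)
have [M0 [_ MP]] := pV _ cF; pose M := M0 + 1.
have := MP M ltac:(rewrite /M; lra) _ (Vh (Num.truncn M)); apply/negP; rewrite -ltNge.
apply: (lt_le_trans (truncnS_gt M)).
rewrite ger0_norm; last by rewrite invr_ge0 ltW.
by rewrite -[leLHS]invrK lef_pV2 ?posrE ?invr_gt0 // ltr0n.
Qed.

(** A compact set is pseudocompact, so it omits some point of the ball; it is also closed, so a
    small ball around that point avoids it. *)
Lemma compact_avoid_sup_ball K g e : compact K -> 0 < e ->
  exists g' e', [/\ 0 < e', sup_ball g e g' & sup_ball g' e' `<=` ~` K].
Proof.
move=> cK e0.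
have [/(sup_ball_not_pseudocompact e0)[]|] := pselect (sup_ball g e `<=` K).
  exact/countably_compact_pseudocompact/compact_countably_compact.
move=> /existsNP[g' /not_implyP[gg' nKg']].
have /closed_openC : closed K := compact_closed hausdorff_Caleph cK.
rewrite openE => /(_ g' nKg') /nbhs_CalephP[A [d [_ d0 dK]]].
exists g', (d / 2); split => //; first by rewrite divr_gt0.
move=> h g'h; apply: dK; apply/BsupP; exists (d / 2) => //; lra.
Qed.

Lemma not_sigma_compact : ~ sigma_compact Y.
Proof.
move=> [K [cK KT]].
(* One Baire step on an index, a centre and a radius. Centre shift and new radius are each at most
   half the old radius, so the balls are nested. *)
have step (np : nat * (C * R)) : exists q : C * R, 0 < np.2.2 ->
    [/\ 0 < q.2, q.2 <= np.2.2 / 2, sup_ball np.2.1 (np.2.2 / 2) q.1 &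
      sup_ball q.1 q.2 `<=` ~` (K np.1 : set C)].
  case: np => n [g e] /=; have [e0|] := ltP 0 e; last by exists (g, e).
  have e2 : 0 < e / 2 by rewrite divr_gt0.
  have [g' [e' [e'0 gg' g'K]]] := compact_avoid_sup_ball g (cK n) e2.
  exists (g', Num.min e' (e / 2)) => _ /=; split => //.
  - by rewrite lt_min e'0.
  - by rewrite ge_min lexx orbT.
  - move=> h g'h; apply: g'K => x; apply: (le_trans (g'h x)).
    by rewrite ge_min lexx.
have [next nextP] := choice step.
have c0 : continuous (fun _ : X => 0 : R) by move=> x; exact: cvg_cst.
pose p := fix p n := if n is m.+1 then next (m, p m) else (mkcts c0 : C, 1 : R).
pose g n := (p n).1; pose e n := (p n).2.
have e_gt0 n : 0 < e n.
  by elim: n => [|n IH]; [exact: ltr01|have [] := nextP (n, p n) IH].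
have pP n : [/\ e n.+1 <= e n / 2, sup_ball (g n) (e n / 2) (g n.+1) &
    sup_ball (g n.+1) (e n.+1) `<=` ~` (K n : set C)].
  by have [] := nextP (n, p n) (e_gt0 n).
have nested m n : (m <= n)%N -> forall x, `|g m x - g n x| <= e m - e n.
  elim: n => [|n IH]; first by rewrite leqn0 => /eqP -> x; rewrite !subrr normr0.
  rewrite leq_eqVlt => /predU1P[-> x|]; first by rewrite !subrr normr0.
  rewrite ltnS => /IH mn x; have [en gn _] := pP n.
  have := ler_distD (g n x) (g m x) (g n.+1 x); have := mn x; have := gn x; lra.
(* The limit is the supremum of the lower ends of the nested intervals
   [[g n x - e n, g n x + e n]]. *)
pose G x := sup (range (fun n => g n x - e n)).
have cross m n x : g n x - e n <= g m x + e m.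
  have := e_gt0 m; have := e_gt0 n.
  by case: (leqP m n) => [|/ltnW] /nested/(_ x); rewrite ler_norml => /andP[]; lra.
have GP n x : `|g n x - G x| <= e n.
  have : g n x - e n <= G x.
    apply: ub_le_sup; last by exists n.
    by exists (g n x + e n) => _ [m _ <-].
  have : G x <= g n x + e n.
    by apply: ge_sup; [exists (g n x - e n), n | move=> _ [m _ <-]].
  by rewrite ler_norml => ? ?; apply/andP; split; lra.
have e_small d : 0 < d -> exists n, e n < d.
  move=> d0.
  (* Halving suffices for this bound because [n + 2 <= 2 (n + 1)]. *)
  have le2 n : e n <= n.+1%:R^-1.
    elim: n => [|n IH]; first by rewrite invr1.
    have [en _ _] := pP n; apply: (le_trans en).
    apply: (@le_trans _ _ (n.+1%:R^-1 / 2)); first by rewrite ler_pM2r // invr_gt0.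
    rewrite -invfM lef_pV2 ?posrE ?mulr_gt0 // -natrM ler_nat; lia.
  have [k] := ltr_add_invr d0; rewrite add0r => kd.
  by exists k; exact: le_lt_trans (le2 k) kd.
have cG : continuous G.
  move=> x; apply/cvgrPdist_le => d d0.
  have [n en] := e_small (d / 3) ltac:(lra).
  have /cvgrPdist_le/(_ (d / 3)) := @cts_fun _ _ (g n) x.
  move=> /(_ ltac:(lra)); apply: filterS => y.
  have := GP n x; have := GP n y.
  rewrite !ler_norml => /andP[? ?] /andP[? ?] /andP[? ?].
  by apply/andP; split; lra.
have [n _ KG] : (\bigcup_n K n) (mkcts cG : C) by rewrite KT.
by have [_ _ /(_ (mkcts cG))] := pP n; apply => //; exact: GP.
Qed.

End infinite.

(** * Finite [X]: compact balls and hemicompactness *)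

Section finite.
Hypotheses (hX : hausdorff_space X) (finX : finite_set [set: X]).

Lemma finite_continuous (F : X -> R) : continuous F.
Proof.
move=> x; have ox : open [set x].
  rewrite -(setCK [set x]); apply: closed_openC.
  apply: (accessible_finite_set_closed.1 (hausdorff_accessible hX)).
  exact: sub_finite_set finX.
have xn : nbhs x [set x] by exact: open_nbhs_nbhs.
by move=> A /nbhs_singleton FA; apply: filterS xn => _ ->.
Qed.

(** Along an ultrafilter, each evaluation converges in a compact segment. The limits form a
    continuous function, and finitely many pointwise limits are uniform. *)
Lemma compact_sup_ball f e : compact (sup_ball f e : set Y).
Proof.
rewrite compact_ultra => F FU FB.
have /choice[G GP] : forall x, exists a : R, `|f x - a| <= e /\ (h : C) x @[h --> F] --> a.
  move=> x; pose ev (h : Y) : R := (h : C) x.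
  have inE a : (a \in `[f x - e, f x + e]) = (`|f x - a| <= e).
    by rewrite in_itv /= distrC ler_distl.
  have [|a [fa clFa]] := @segment_compact R (f x - e) (f x + e) (ev @ F) _.
    suff : F (ev @^-1` `[f x - e, f x + e]) by [].
    by apply: filterS FB => h hB; rewrite /= inE; exact: hB.
  exists a; split; first by rewrite -inE.
  (* For an ultrafilter, a cluster point is a limit: otherwise the complement of [W] would belong to
     the image filter. *)
  move=> W Wa; have [//|nW] := in_ultra_setVsetC (ev @^-1` W) FU.
  by have [r [nWr Wr]] := clFa (~` W) W nW Wa.
pose g : C := mkcts (@finite_continuous G).
exists (g : Y); split; first by move=> x; have [] := GP x.
move=> V /nbhs_CalephP[A [d [_ d0 dV]]].
have /finite_seqP[s sE] := finX.
have : F [set h : Y | forall x, x \in s -> `|G x - (h : C) x| <= d / 2].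
  elim: s {sE} => [|y s IH]; first by apply: filterS filterT.
  have [_ /cvgrPdist_le/(_ (d / 2))] := GP y.
  move=> /(_ ltac:(lra)) Fy; apply: filterS2 Fy IH => h hy hs x.
  by rewrite inE => /predU1P[->|/hs].
apply: filterS => h hP; apply: dV; apply/BsupP; exists (d / 2); first by lra.
move=> x _; apply: hP; have : [set: X] x by [].
by rewrite sE.
Qed.

Lemma locally_compact_Caleph : every_point_has_nbhs (@compact Y).
Proof.
move=> f; exists (sup_ball f 1); last exact: compact_sup_ball.
apply: filterS (nbhs_Bsup f (finite_set_countable finX) ltr01).
by move=> g /BsupP[r /ltW r1 fg] x; exact: le_trans (fg x I) r1.
Qed.

(** The open balls around 0 are increasing and cover the space, so a compact set lies in one of
    them. *)
Lemma hemicompact_Caleph : hemicompact Y.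
Proof.
pose z : C := mkcts (@finite_continuous (fun=> 0)).
exists (fun n => sup_ball z n%:R); split; first by move=> n; exact: compact_sup_ball.
move=> L /compact_countably_compact cL.
have [n|g _|D _ LD] := cL (fun n => Bsup z setT n.+1%:R).
- by apply: open_Bsup => //; exact/countable_card_lt/finite_set_countable.
- have /finite_seqP[s sE] := finX.
  exists (\max_(x <- s) (Num.truncn `|g x|).+1)%N => //.
  apply/BsupP; exists (\max_(x <- s) (Num.truncn `|g x|).+1)%N%:R.
    by rewrite ltr_nat.
  move=> x Xx; rewrite sub0r normrN; apply: (le_trans (ltW (truncnS_gt _))).
  rewrite ler_nat; apply: (bigmaxn_sup_seq x) => //.
  by move: Xx; rewrite sE.
exists (\max_(i <- finmap.enum_fset D) i.+1)%N => g /LD[i /= iD].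
move=> /BsupP[r ri gr] x; apply: (le_trans (gr x I)); apply: (le_trans (ltW ri)).
by rewrite ler_nat; exact: bigmaxn_sup_seq iD _ _.
Qed.

End finite.
End function_space.

Theorem theorem3p28 (R : realType) (X : topologicalType)
    (kappa : infinite_cardinal) :
  tychonoff_space X ->
  ~ countable [set: kappa] ->
  [<-> finite_set [set: X];
       every_point_has_nbhs (@compact (Caleph kappa X R));
       every_point_has_nbhs (@countably_compact (Caleph kappa X R));
       every_point_has_nbhs (@pseudocompact (Caleph kappa X R) R);
       hemicompact (Caleph kappa X R);
       sigma_compact (Caleph kappa X R)].
Proof.
move=> tX ncK; tfae.
- by move=> finX; apply: locally_compact_Caleph => //; have [] := tX.
- move=> lc f; have [V fV /compact_countably_compact cV] := lc f.
  by exists V.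
- move=> lc f; have [V fV /countably_compact_pseudocompact cV] := lc f.
  by exists V.
(* This implication passes through finiteness of [X]: a pseudocompact neighbourhood of 0 contains a
   [sup_ball]. *)
- move=> lp; apply: hemicompact_Caleph => //; first by have [] := tX.
  apply: contrapT => infX.
  have c0 : continuous (fun _ : X => 0 : R) by move=> x; exact: cvg_cst.
  have [V /nbhs_CalephP[A [e [_ e0 eV]]]] := lp (mkcts c0).
  have e2 : 0 < e / 2 by rewrite divr_gt0.
  apply: (sup_ball_not_pseudocompact ncK tX infX e2) => g zg.
  by apply: eV; apply/BsupP; exists (e / 2) => //; lra.
- move=> [K [cK KL]]; exists K; split => //.
  apply/seteqP; split => // g _.
  by have [n gK] := KL _ (@compact_set1 _ g); exists n => //; exact: gK.
- by move=> sc; apply: contrapT => infX; exact: (not_sigma_compact ncK tX infX sc).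
Qed.
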